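(* Let $M_m$ be the number of all binary snake names of length $2m$ (up to equivalence), and let $M_m(j,k)$ be the number of binary snake names (up to equivalence) of length $2m>2$ with parameters $j$ and $k$. Then $M_1=1$, $M_2=M_2(3,4)=1$ and, for $m\ge2$ and all integers $j,k$ with $3\le j<k$ and $5\le k\le m+3$, $$M_{m+1}(j,k)=M_{m,A}(j,k)+M_{m,B}(j,k),$$ where $$M_{m,A}(j,k)=\sum_{l=k-1}^{m+2}M_m(k-2,l)\qquad\text{and}\qquad M_{m,B}(j,k)=(2m-k+1)\,M_m(j-1,k-1).$$ Consequently, $$M_{m+1}=\sum_{3\le j<k,\ 5\le k\le m+3}M_{m+1}(j,k).$$
   Context: A word is a finite sequence $W=[w_1\cdots w_m]$ of letters; a subword $[w_j\cdots w_k]$ consists of consecutive entries, and $[w_j\cdots w_k)$ consists of the entries in positions $j,\ldots,k-1$. Two words of length $m$ are equivalent if they define the same partition of $\{1,\ldots,m\}$ into sets of positions of equal letters. A word is primitive if it has no repeated letters. A word $[w_1\cdots w_m]$ is semi-primitive if $w_1=w_m$ and $[w_1\cdots w_m)$ is primitive. A word is binary if each of its letters appears in it exactly twice. A non-empty word $W=[w_1\cdots w_m]$ is a snake name if (i) each letter of $W$ appears in $W$ at least twice; (ii) for any $k\in\{2,\ldots,m-1\}$ there is a semi-primitive subword $[w_j\cdots w_l]$ of $W$ with $j<k<l$. A binary snake name is a snake name which is a binary word. For a binary snake name $W=[w_1\cdots w_{2m}]$ with $2m>2$, its parameters are the numbers $j$ and $k$, where $j$ is the position of the second occurrence of the first letter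 $w_1$, and $w_k$ is the first entry of $W$ such that $[w_2\cdots w_k]$ is not primitive. $M_m(j,k)=0$ when there are no binary snake names of length $2m$ with parameters $j,k$. *)

(* Defs.v *)
From mathcomp Require Import all_boot.

Set Implicit Arguments.
Unset Strict Implicit.
Unset Printing Implicit Defensive.

Section Words.

Variable T : eqType.
Implicit Type W : seq T.

(* [w_j ... w_k], where positions are numbered from 1. *)
Definition subword W (j k : nat) : seq T := drop j.-1 (take k W).

Definition primitive W : bool := uniq W.

(* For W = x :: s, belast x s is [w_1 ... w_m). *)
Definition semi_primitive W : bool :=
  if W is x :: s then (x == last x s) && primitive (belast x s) else false.

Definition binary W : bool := all (fun x => count_mem x W == 2) W.

Definition snake_name W : bool :=
  [&& W != [::],
      all (fun x => 2 <= count_mem x W) W &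
      [forall k : 'I_(size W), (2 <= k) ==>
        [exists j : 'I_(size W).+1, exists l : 'I_(size W).+1,
          [&& 1 <= j, j < k, k < l & semi_primitive (subword W j l)]]]].

Definition binary_snake_name W : bool := snake_name W && binary W.

(* Position of the second occurrence of the first letter, numbered from 1; it
   is (size W).+1 if there is no second occurrence. *)
Definition param_j W : nat := if W is x :: s then (index x s).+2 else 0.

(* Least k such that [w_2 ... w_k] is not primitive; it is (size W).+1 if there
   is no such k. Here find returns k itself since iota starts at 0, and
   subword W 2 k is empty for k <= 1. *)
Definition param_k W : nat :=
  find (fun k => ~~ primitive (subword W 2 k)) (iota 0 (size W).+1).

End Words.

(* The partition of the positions into sets of positions of equal letters. *)
Definition position_partition n (T : eqType) (W : n.-tuple T) :
    {set {set 'I_n}} :=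
  preim_partition (tnth W) [set: 'I_n].

Definition equivalent n (T1 T2 : eqType)
    (W1 : n.-tuple T1) (W2 : n.-tuple T2) : bool :=
  position_partition W1 == position_partition W2.

(* Number of equivalence classes of words of length n satisfying P. A word of
   length n has at most n distinct letters, so up to equivalence its letters
   can be taken in 'I_n. *)
Definition nb_words n (P : pred (seq 'I_n)) : nat :=
  #|equivalence_partition (fun U V : n.-tuple 'I_n => equivalent U V)
      [set W : n.-tuple 'I_n | P W]|.

Definition nb_snakes (m : nat) : nat :=
  nb_words (fun W : seq 'I_(2 * m) => binary_snake_name W).

Definition nb_snakes_jk (m j k : nat) : nat :=
  nb_words (fun W : seq 'I_(2 * m) =>
    [&& binary_snake_name W, param_j W == j & param_k W == k]).

Definition nb_snakesA (m j k : nat) : nat :=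
  \sum_(k - 1 <= l < m + 3) nb_snakes_jk m (k - 2) l.

Definition nb_snakesB (m j k : nat) : nat :=
  (2 * m + 1 - k) * nb_snakes_jk m (j - 1) (k - 1).

(* Main.v *)
(* A binary word of length n is determined up to equivalence by the involution
   exchanging the two occurrences of each letter, that is, by a set of arcs
   matching n positions; its semi-primitive subwords are the arcs with no arc
   nested inside.  In a snake name of length 2m + 2 the arc of w_1 has nothing
   nested inside, hence j < k, and no arc has both ends in [2, k).

   If w_2 = w_k, deleting the arc of w_1 yields an arbitrary snake name with
   first arc ending at k - 2, and j can be any position in [3, k): the arc from
   2 to k takes over the covering of the lost positions.  This is case A.
   Otherwise the arc of w_2 ends at some q > k, contains the arc ending at k, so
   covers nothing: deleting it yields a snake name with parameters j - 1, k - 1,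
   and q can be any position in (k, 2m + 2), where q = 2m + 2 is excluded because
   position 2m + 1 must be covered.  This is case B. *)

Require Import Defs.
From mathcomp Require Import all_boot zify.

Set Implicit Arguments.
Unset Strict Implicit.
Unset Printing Implicit Defensive.

(** * Matchings, nested arcs and covered positions *)

Local Notation "s .[ i ]" := (nth 0 s i)
  (at level 1, left associativity, format "s .[ i ]").

(* A matching is the sequence [s] whose entry [s.[i]] is the other end of the arc
   at position [i].  Positions start at 0, so that the parameters of a word are
   [s.[0].+1] and [(first_closure n s).+1]. *)
Definition matching n (s : seq nat) :=
  (size s == n) &&
  all (fun i => [&& s.[i] < n, s.[i] != i & s.[s.[i]] == i]) (iota 0 n).

(** The arcs left by this test are the semi-primitive subwords; nested arcs are sought through their
    right ends [d]. *)
Definition unnested (s : seq nat) a :=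
  (a < s.[a]) && all (fun d => ~~ (a < s.[d] < d)) (iota 0 s.[a]).

(** Condition (ii) of a snake name; only the positions 0 and [n - 1] are exempt. *)
Definition covered n (s : seq nat) :=
  all (fun p => has (fun a => (p < s.[a]) && unnested s a) (iota 0 p))
    (iota 1 (n - 2)).

(** The bound [0 <] leaves out the arc of 0, because the parameter [k] concerns repetitions after
    the first letter. The value is [n] if there is no such right end. *)
Definition first_closure n (s : seq nat) :=
  find (fun b => 0 < s.[b] < b) (iota 0 n).

Definition snake n s := matching n s && covered n s.

Lemma matchingP n s :
  reflect (size s = n /\
           forall i, i < n -> [/\ s.[i] < n, s.[i] <> i & s.[s.[i]] = i])
          (matching n s).
Proof.
apply: (iffP andP) => [[/eqP szs /allP H]|[-> H]]; split=> //.
  by move=> i lt_in; have /and3P[? /eqP ? /eqP ?] : _ := H i ltac:(rewrite mem_iota; lia).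
apply/allP => i; rewrite mem_iota => lt_in.
by have [? /eqP ? /eqP ?] : _ := H i ltac:(lia); apply/and3P.
Qed.

Lemma unnestedP s a :
  reflect (a < s.[a] /\ forall d, d < s.[a] -> a < s.[d] -> s.[d] < d -> False)
          (unnested s a).
Proof.
apply: (iffP andP) => [[-> /allP H]|[-> H]]; split=> //.
  by move=> d ltd ? ?; have := H d ltac:(rewrite mem_iota; lia); lia.
apply/allP => d; rewrite mem_iota => ltd; apply/negP => ?.
by apply: (H d); lia.
Qed.

Lemma coveredP n s :
  reflect (forall p, 0 < p -> p.+1 < n ->
             exists a, [/\ a < p, p < s.[a] & unnested s a])
          (covered n s).
Proof.
apply: (iffP allP) => H p.
  move=> p0 ltpn; have /hasP[a] := H p ltac:(rewrite mem_iota; lia).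
  by rewrite mem_iota => ? /andP[? ?]; exists a; split=> //; lia.
rewrite mem_iota => ltpn; have [a [? ? ?]] := H p ltac:(lia) ltac:(lia).
by apply/hasP; exists a; [rewrite mem_iota; lia | apply/andP].
Qed.

Lemma find_iota (p : pred nat) l k : k <= l ->
  (forall i, i < k -> ~~ p i) -> (k < l -> p k) -> find p (iota 0 l) = k.
Proof.
move=> le_kl Hlt Hk; apply/eqP; rewrite eqn_leq.
apply/andP; split; rewrite leqNgt; apply/negP => lt.
  have lt_kl : k < l by rewrite (leq_trans lt) // -{2}(size_iota 0 l) find_size.
  by have := before_find 0 lt; rewrite nth_iota // Hk.
have has_p : has p (iota 0 l) by rewrite has_find size_iota (leq_trans lt).
have := nth_find 0 has_p; rewrite nth_iota; last by rewrite (leq_trans lt).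
by rewrite add0n (negPf (Hlt _ lt)).
Qed.

Lemma first_closureP n s b :
  b < n ->
  reflect (0 < s.[b] < b /\ forall c, c < b -> 0 < s.[c] -> s.[c] < c -> False)
          (first_closure n s == b).
Proof.
move=> lt_bn; rewrite /first_closure; set a := (X in find X).
apply: (iffP eqP) => [Eb|[ab H]].
  have ha : has a (iota 0 n) by rewrite has_find Eb size_iota.
  split=> [|c lt_cb]; first by have := nth_find 0 ha; rewrite Eb nth_iota.
  have := @before_find _ 0 a (iota 0 n) c.
  by rewrite Eb nth_iota ?add0n /a; lia.
apply: find_iota => // [|i lt_ib]; first by lia.
by apply/negP => /andP[]; apply: H.
Qed.

(** * Constraints on the first arc and the first closure *)

Section SnakeShape.

Variables (n : nat) (s : seq nat).
Hypotheses (n_ge4 : 4 <= n) (snake_s : snake n s).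

Let b := first_closure n s.

(** Position 1 must be covered, and only an arc starting at 0 can do this. *)
Lemma snake_first_arc : unnested s 0 /\ 2 <= s.[0].
Proof.
case/andP: snake_s => _ /coveredP/(_ 1 isT) H.
have [|a [lt_a1 lt1 una]] := H; first by lia.
have a0 : a = 0 by lia.
by rewrite a0 in una lt1.
Qed.

(** A closure before [s.[0]] would be an arc nested in the first one. A closure exists because
    [s.[0]] is itself covered, by an arc that starts after 0. *)
Lemma snake_first_closure :
  [/\ s.[0] < b, b < n & 0 < s.[b] < b /\
      forall c, c < b -> 0 < s.[c] -> s.[c] < c -> False].
Proof.
have [/unnestedP[_ H0] s0_ge2] := snake_first_arc.
case/andP: snake_s => /matchingP[_ ms] /coveredP cov.
have [m00 m01 m02] := ms 0 ltac:(lia).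
have [m10 m11 m12] := ms 1 ltac:(lia).
have s1_neq0 : s.[1] <> 0 by move=> E; rewrite E in m12; lia.
(* A first arc ending at the last position would contain the arc of 1. *)
have s0_ltn : s.[0].+1 < n.
  rewrite ltnNge; apply/negP => le_n.
  have s1_neqn : s.[1] <> s.[0] by move=> E; rewrite E in m12; lia.
  by apply: (H0 s.[1]); lia.
have [a [lt_a lt_sa /unnestedP[una Ha]]] := cov s.[0] ltac:(lia) s0_ltn.
have a_neq0 : a <> 0 by move=> a0; rewrite a0 in lt_sa; lia.
have [ma0 ma1 ma2] := ms a ltac:(lia).
have lt_bn : b < n.
  rewrite -[n in _ < n](size_iota 0) -has_find; apply/hasP; exists s.[a].
    by rewrite mem_iota; lia.
  by lia.
have /first_closureP-/(_ lt_bn)[/andP[sb0 sbb] H] := eqxx b.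
split; rewrite ?sb0 //.
case: (ltngtP s.[0] b) => // [lt_bs|Eb]; first by case: (H0 b).
by rewrite -Eb m02 in sb0.
Qed.

(** If [b = 3], the arcs are 0-2 and 1-3, so no arc starting before 3 ends after it; but 3 is not
    the last position and has to be covered. *)
Lemma snake_first_closure_ge4 : 6 <= n -> 4 <= b.
Proof.
move=> n_ge6; have [lt_sb lt_bn [sbb H]] := snake_first_closure.
have [_ s0_ge2] := snake_first_arc.
case/andP: snake_s => /matchingP[_ ms] /coveredP cov.
rewrite ltnNge; apply/negP => b_le3.
have b3 : b = 3 by lia.
have s02 : s.[0] = 2 by lia.
rewrite b3 in sbb.
have [_ _ m0] := ms 0 ltac:(lia); rewrite s02 in m0.
have [_ _ m3] := ms 3 ltac:(lia).
have s31 : s.[3] = 1.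
  by case: (s.[3]) sbb m3 => [|[|[|k]]] //; rewrite m0.
rewrite s31 in m3.
have [[|[|[|a]]] [? ?]] := cov 3 isT ltac:(lia); lia.
Qed.

(* No arc joins two positions of [1, b[, so [s] maps this interval injectively
   into its complement. *)
Lemma snake_first_closure_le : b.*2 <= n.+2.
Proof.
have [lt_sb lt_bn [sbb H]] := snake_first_closure.
case/andP: snake_s => /matchingP[_ ms] _.
have uniq_im : uniq (map (nth 0 s) (iota 1 b.-1)).
  rewrite map_inj_in_uniq ?iota_uniq // => x y; rewrite !mem_iota => ltx lty E.
  have [_ _ mx] := ms x ltac:(lia); have [_ _ my] := ms y ltac:(lia).
  by rewrite -mx -my E.
have := @uniq_leq_size _ (map (nth 0 s) (iota 1 b.-1) ++ iota 1 b.-1) (iota 0 n).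
rewrite cat_uniq uniq_im iota_uniq andbT /= size_cat size_map !size_iota.
have -> : ~~ has (in_mem^~ (mem (map (nth 0 s) (iota 1 b.-1)))) (iota 1 b.-1).
  apply/hasP => -[y]; rewrite mem_iota => lty /mapP[x]; rewrite mem_iota => ltx Ey.
  have [_ nx mx] := ms x ltac:(lia); rewrite -Ey in mx.
  case: (ltngtP x y) => [ltxy|ltyx|Exy]; last by case: nx; rewrite -Ey.
    by apply: (H y); lia.
  by apply: (H x); lia.
move=> /(_ isT) sub; suff: b.-1 + b.-1 <= n by lia.
apply: sub => y; rewrite mem_cat !mem_iota => /orP[/mapP[x]|]; last by lia.
by rewrite mem_iota => ltx ->; have [] := ms x ltac:(lia); lia.
Qed.

End SnakeShape.

(** * Inserting and deleting an arc *)

(* [gap p q] is the increasing enumeration of the positions other than [p < q]. *)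
Definition gap p q i := bump q (bump p i).
Definition ungap p q i := unbump p (unbump q i).

Definition insert_arc p q (s : seq nat) :=
  mkseq (fun i => if i == p then q else if i == q then p
                  else gap p q s.[ungap p q i]) (size s).+2.

Definition delete_arc p q (s : seq nat) :=
  mkseq (fun i => ungap p q s.[gap p q i]) (size s - 2).

Section Arc.

Variables (p q : nat).
Hypothesis lt_pq : p < q.

Lemma gapK : cancel (gap p q) (ungap p q).
Proof. by move=> i; rewrite /gap /ungap /bump /unbump; lia. Qed.

Lemma ungapK i : i != p -> i != q -> gap p q (ungap p q i) = i.
Proof. by rewrite /gap /ungap /bump /unbump; lia. Qed.

Lemma ltn_gap i j : (gap p q i < gap p q j) = (i < j).
Proof. by rewrite /gap /bump; lia. Qed.

Lemma gap_neql i : gap p q i != p.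
Proof. by rewrite /gap /bump; lia. Qed.

Lemma gap_neqr i : gap p q i != q.
Proof. by rewrite /gap /bump; lia. Qed.

Lemma gap_surj i : i != p -> i != q -> {j | i = gap p q j}.
Proof. by move=> ? ?; exists (ungap p q i); rewrite ungapK. Qed.

Variable n : nat.
Hypothesis lt_qn : q < n.+2.

Lemma gap_bound i : (gap p q i < n.+2) = (i < n).
Proof. by rewrite /gap /bump; lia. Qed.

Lemma nth_insert_arcl s : size s = n -> (insert_arc p q s).[p] = q.
Proof. by move=> sz; rewrite nth_mkseq ?sz ?eqxx //; lia. Qed.

Lemma nth_insert_arcr s : size s = n -> (insert_arc p q s).[q] = p.
Proof. by move=> sz; rewrite nth_mkseq ?sz ?eqxx ?gtn_eqF. Qed.

Lemma nth_insert_gap s i :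
  size s = n -> i < n -> (insert_arc p q s).[gap p q i] = gap p q s.[i].
Proof.
move=> sz lt_in; rewrite nth_mkseq ?sz ?gap_bound //.
by rewrite (negPf (gap_neql i)) (negPf (gap_neqr i)) gapK.
Qed.

Lemma matching_insert s : matching n s -> matching n.+2 (insert_arc p q s).
Proof.
case/matchingP => sz ms; apply/matchingP; split; first by rewrite size_mkseq sz.
move=> i lt_in.
have [->|neq_p] := eqVneq i p.
  by rewrite nth_insert_arcl // nth_insert_arcr //; split=> //; lia.
have [->|neq_q] := eqVneq i q.
  by rewrite nth_insert_arcr // nth_insert_arcl //; split=> //; lia.
have [j Ei] := gap_surj neq_p neq_q; rewrite Ei in lt_in *.
rewrite gap_bound in lt_in; have [? ? mj] := ms j lt_in.
rewrite nth_insert_gap // nth_insert_gap // mj gap_bound; split=> //.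
by move/(can_inj gapK).
Qed.

Lemma nth_delete_arc s i :
  size s = n.+2 -> i < n -> (delete_arc p q s).[i] = ungap p q s.[gap p q i].
Proof. by move=> sz lt_in; rewrite nth_mkseq // sz; lia. Qed.

(** Since [p] and [q] are matched with each other, the remaining positions are matched among
    themselves. *)
Lemma matching_gap s i : matching n.+2 s -> s.[p] = q -> i < n ->
  exists2 j, j < n & s.[gap p q i] = gap p q j.
Proof.
case/matchingP => sz ms spq lt_in.
have [lti nei mi] := ms (gap p q i) ltac:(by rewrite gap_bound).
have [_ _ mp] := ms p ltac:(lia).
have neq_p : s.[gap p q i] != p.
  by apply/eqP => E; have := gap_neqr i; rewrite -mi E spq eqxx.
have neq_q : s.[gap p q i] != q.
  by apply/eqP => E; have := gap_neql i; rewrite -mi E -spq mp eqxx.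
by have [j Ej] := gap_surj neq_p neq_q; exists j => //; rewrite -gap_bound -Ej.
Qed.

Lemma matching_delete s :
  matching n.+2 s -> s.[p] = q -> matching n (delete_arc p q s).
Proof.
move=> ms spq; have [sz H] := matchingP _ _ ms.
apply/matchingP; split; first by rewrite size_mkseq sz; lia.
move=> i lt_in; have [j lt_jn Ej] := matching_gap ms spq lt_in.
have [_ ni mi] := H (gap p q i) ltac:(by rewrite gap_bound).
rewrite nth_delete_arc // Ej gapK nth_delete_arc // -Ej mi gapK; split=> //.
by move=> Eji; rewrite Ej Eji in ni.
Qed.

Lemma insert_arcK s : matching n s -> delete_arc p q (insert_arc p q s) = s.
Proof.
case/matchingP => sz ms.
apply: (@eq_from_nth _ 0) => [|i]; first by rewrite !size_mkseq; lia.
rewrite !size_mkseq => lt_i; have lt_in : i < n by lia.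
rewrite nth_delete_arc ?size_mkseq ?sz // nth_insert_gap //.
by rewrite gapK.
Qed.

Lemma delete_arcK s :
  matching n.+2 s -> s.[p] = q -> insert_arc p q (delete_arc p q s) = s.
Proof.
move=> ms spq; have [sz H] := matchingP _ _ ms.
have [szd _] := matchingP _ _ (matching_delete ms spq).
apply: (@eq_from_nth _ 0) => [|i]; first by rewrite size_mkseq szd.
rewrite size_mkseq szd => lt_in.
have [->|neq_p] := eqVneq i p; first by rewrite nth_insert_arcl.
have [->|neq_q] := eqVneq i q.
  by rewrite nth_insert_arcr // -spq; have [] := H p ltac:(lia).
have [j Ei] := gap_surj neq_p neq_q; rewrite Ei in lt_in *.
rewrite gap_bound in lt_in; have [k _ Ek] := matching_gap ms spq lt_in.
by rewrite nth_insert_gap // nth_delete_arc // Ek gapK.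
Qed.

(** As [gap] preserves order, nesting among the old arcs does not change; the only new arc that can
    be nested in an old one is the inserted arc. *)
Lemma unnested_insert s a : matching n s -> a < n ->
  unnested (insert_arc p q s) (gap p q a) =
  unnested s a && ~~ ((gap p q a < p) && (q < gap p q s.[a])).
Proof.
case/matchingP => sz ms lt_an; have [lt_sa _ _] := ms a lt_an.
apply/unnestedP/andP; rewrite nth_insert_gap //.
  case; rewrite ltn_gap => lt_a H; split.
    apply/unnestedP; split=> // d ltd lt_asd lt_sdd.
    have lt_dn : d < n by lia.
    by apply: (H (gap p q d)); rewrite ?nth_insert_gap ?ltn_gap.
  apply/negP => /andP[lt_ap lt_qa].
  by apply: (H q); rewrite ?nth_insert_arcr.
case=> /unnestedP[lt_a H] Hpq; rewrite ltn_gap; split=> // d ltd.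
have [->|neq_p] := eqVneq d p; first by rewrite nth_insert_arcl; lia.
have [Eq|neq_q] := eqVneq d q; first by rewrite Eq nth_insert_arcr; lia.
have [e Ed] := gap_surj neq_p neq_q; rewrite Ed ltn_gap in ltd *.
have lt_en : e < n by lia.
by rewrite nth_insert_gap // !ltn_gap; apply: H.
Qed.

End Arc.

(** * Counting matchings *)

(** A duplicate-free finite list that contains all matchings of [n] positions, so that they can be
    counted by filtering. *)
Fixpoint words n l : seq (seq nat) :=
  if l is l'.+1 then [seq x :: w | x <- iota 0 n, w <- words n l'] else [:: [::]].

Definition cnt n (Q : pred (seq nat)) := count Q (words n n).

Lemma mem_words n l w :
  (w \in words n l) = (size w == l) && all (fun x => x < n) w.
Proof.
elim: l w => [|l IH] [|x w] //=; first by apply/allpairsP => -[[? ?] []].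
apply/allpairsP/andP => [[[y v] /= []]|[szw /andP[ltx allw]]].
  by rewrite mem_iota IH => lty /andP[? ?] [-> ->]; rewrite eqSS; split; first done; apply/andP.
by exists (x, w); rewrite /= mem_iota IH -eqSS szw allw.
Qed.

Lemma words_uniq n l : uniq (words n l).
Proof.
elim: l => [|l IH] //=; apply: allpairs_uniq => //; first exact: iota_uniq.
by move=> [? ?] [? ?] _ _ /= [-> ->].
Qed.

Lemma matching_words n s : matching n s -> s \in words n n.
Proof.
case/matchingP => sz ms; rewrite mem_words sz eqxx.
by apply/(all_nthP 0) => i; rewrite sz => /ms[].
Qed.

(** [insert_arc p q] and [delete_arc p q] are inverse bijections between the two filtered lists. *)
Lemma cnt_insert n p q (Q : pred (seq nat)) : p < q < n.+2 ->
  cnt n.+2 (fun s => [&& matching n.+2 s, s.[p] == q & Q s]) =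
  cnt n (fun s => matching n s && Q (insert_arc p q s)).
Proof.
case/andP=> lt_pq lt_qn; rewrite /cnt -!size_filter -[RHS](size_map (insert_arc p q)).
apply: perm_size; apply: uniq_perm.
- by rewrite filter_uniq ?words_uniq.
- rewrite map_inj_in_uniq ?filter_uniq ?words_uniq // => s t.
  rewrite !mem_filter => /andP[/andP[ms _] _] /andP[/andP[mt _] _] E.
  by rewrite -(insert_arcK lt_pq lt_qn ms) E (insert_arcK lt_pq lt_qn mt).
move=> s; rewrite mem_filter; apply/andP/mapP => [[/and3P[ms /eqP sp Qs] _]|].
  have md := matching_delete lt_pq lt_qn ms sp.
  exists (delete_arc p q s); last by rewrite (delete_arcK lt_pq lt_qn).
  by rewrite mem_filter md (delete_arcK lt_pq lt_qn) // Qs matching_words.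
case=> t; rewrite mem_filter => /andP[/andP[mt Qt] _] ->.
have mi := matching_insert lt_pq lt_qn mt; have [szt _] := matchingP _ _ mt.
by rewrite mi Qt (nth_insert_arcl lt_pq lt_qn) // eqxx matching_words.
Qed.

Lemma eq_cnt n (P Q : pred (seq nat)) : P =1 Q -> cnt n P = cnt n Q.
Proof. by move=> PQ; apply: eq_count. Qed.

Lemma cnt_split n (g : seq nat -> nat) x y (Q : pred (seq nat)) :
  (forall s, Q s -> x <= g s < y) ->
  cnt n Q = \sum_(x <= i < y) cnt n (fun s => Q s && (g s == i)).
Proof.
move=> gQ; rewrite /cnt -sum1_count.
under [RHS]eq_bigr => i _ do rewrite -sum1_count big_mkcondr.
(* After the exchange each [s] contributes the number of [i] equal to [g s] in the range, which is
   1. *)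
rewrite exchange_big /=; apply: eq_bigr => s Qs.
rewrite -big_mkcond /= sum1_count (eq_count (a2 := pred1 (g s))); last first.
  by move=> i; rewrite /= eq_sym.
by rewrite count_uniq_mem ?iota_uniq // mem_index_iota gQ.
Qed.

(** * Case A: inserting an arc at the first position *)

Section InsertFirstArc.

Variables (n j b : nat) (s : seq nat).
Hypotheses (n_ge4 : 4 <= n) (j_ge2 : 2 <= j) (lt_jb : j < b) (lt_bn : b < n.+2).
Hypotheses (b_ge4 : 4 <= b) (matching_s : matching n s).

Let t := insert_arc 0 j s.

(** No arc can contain one that starts at 0, so the old arcs stay unnested or nested as they were;
    the first arc of [s] becomes the arc from 1 to [b]. *)
Lemma insert_first_arc :
  [&& covered n.+2 t, first_closure n.+2 t == b & t.[1] == b] =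
  covered n s && (s.[0] == b - 2).
Proof.
have lt_jn : j < n.+2 by lia.
have j_gt0 : 0 < j by lia.
have [sz ms] := matchingP _ _ matching_s.
have t0 : t.[0] = j by apply: (@nth_insert_arcl _ _ _ n).
have tj : t.[j] = 0 by apply: (@nth_insert_arcr _ _ _ n).
have tg i : i < n -> t.[gap 0 j i] = gap 0 j s.[i] by apply: nth_insert_gap.
have gapE i : gap 0 j i = (j <= i.+1) + i.+1 by [].
have unt a : a < n -> unnested t (gap 0 j a) = unnested s a.
  by move=> lt_an; rewrite (@unnested_insert _ _ _ n) // ltn0 andbT.
have g0 : gap 0 j 0 = 1 by rewrite gapE; lia.
have gb : gap 0 j (b - 2) = b by rewrite gapE; lia.
have t1 : t.[1] = gap 0 j s.[0] by rewrite -g0 tg //; lia.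
have -> : (t.[1] == b) = (s.[0] == b - 2).
  by rewrite t1 -{1}gb (inj_eq (can_inj (@gapK 0 j j_gt0))).
case: (s.[0] =P b - 2) => s0; rewrite ?andbF // !andbT.
apply/andP/idP => [[/coveredP cov /first_closureP-/(_ lt_bn)[tb H]]|/coveredP cov].
  have uns0 : unnested s 0.
    apply/unnestedP; split=> [|d ltd sd0 sdd]; first by lia.
    have lt_dn : d < n by lia.
    apply: (H (gap 0 j d)); last by rewrite tg // ltn_gap.
      by rewrite -gb ltn_gap // -s0.
    by rewrite tg // /gap /bump; lia.
  apply/coveredP => p p_gt0 lt_pn.
  have [a [lt_a lt_ta una]] :=
    cov (gap 0 j p) ltac:(rewrite gapE; lia) ltac:(rewrite gapE; lia).
  (* What the inserted arc covers is covered in [s] by the arc from 0 to [b - 2], as [j < b]. *)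
  have [a0|a_neq0] := eqVneq a 0.
    by exists 0; split=> //; move: lt_ta; rewrite a0 t0 s0 gapE; lia.
  have [aj|a_neqj] := eqVneq a j; first by rewrite aj tj in lt_ta.
  have [e Ea] := gap_surj j_gt0 a_neq0 a_neqj.
  rewrite Ea ltn_gap // in lt_a; have lt_en : e < n by lia.
  by exists e; rewrite -(unt e) // -Ea -(ltn_gap j_gt0 p) -tg // -Ea.
(* Position 1 of [s] can be covered only from 0, so the first arc of [s] is unnested; this excludes
   any closure of [t] before [b]. *)
have [|a [lt_a1 lt_1sa una]] := cov 1 isT; first by lia.
have a0 : a = 0 by lia.
rewrite {a lt_a1 lt_1sa}a0 in una.
have /unnestedP[_ H] := una.
have no_closure c : c < b -> 0 < t.[c] -> t.[c] < c -> False.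
  move=> lt_cb.
  have [->|c_neq0] := eqVneq c 0; first by rewrite ltn0.
  have [->|c_neqj] := eqVneq c j; first by rewrite tj.
  have [e Ec] := gap_surj j_gt0 c_neq0 c_neqj.
  rewrite Ec -gb ltn_gap // in lt_cb *.
  have lt_en : e < n by lia.
  rewrite tg // ltn_gap // => _ lt_se.
  have [_ _ mse] := ms e lt_en.
  apply: (H e) => //; first by lia.
  by rewrite lt0n; apply/eqP => se0; rewrite se0 s0 in mse; lia.
split.
  (* Left of [j] the inserted arc covers, right of [j] a shifted arc of [s]; [j] itself is covered
     by the arc from 1 to [b]. *)
  apply/coveredP => p p_gt0 lt_pn; have [lt_pj|lt_jp|->] := ltngtP p j.
  - exists 0; rewrite t0; split=> //; apply/unnestedP; rewrite t0; split=> //.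
    by move=> d ltd; apply: no_closure; lia.
  - have [e Ep] := @gap_surj 0 j j_gt0 p ltac:(lia) ltac:(lia).
    have [||a [lt_ae lt_esa una']] := cov e; try by move: Ep; rewrite gapE; lia.
    have lt_an : a < n by move: Ep; rewrite gapE; lia.
    by exists (gap 0 j a); rewrite unt // tg // Ep !ltn_gap.
  by exists 1; rewrite t1 s0 gb; split=> //; rewrite -g0 unt //; lia.
apply/first_closureP => //; split=> //.
have [_ _ m0] := ms 0 ltac:(lia).
by rewrite -{1 2}gb tg -?s0 ?m0 ?g0; lia.
Qed.

End InsertFirstArc.

(** * Case B: inserting an arc at the second position *)

Section InsertSecondArc.

Variables (n j b q : nat) (s : seq nat).
Hypotheses (n_ge4 : 4 <= n) (j_ge2 : 2 <= j) (lt_jb : j < b).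
Hypotheses (lt_bq : b < q) (le_qn : q <= n).
Hypotheses (b_ge4 : 4 <= b) (matching_s : matching n s).

Let t := insert_arc 1 q s.

(** The inserted arc is not nested in any old arc and covers nothing itself, so covers transfer in
    both directions. Only its two ends need new covers. *)
Lemma insert_second_arc :
  [&& covered n.+2 t, t.[0] == j & first_closure n.+2 t == b] =
  [&& covered n s, s.[0] == j.-1 & first_closure n s == b.-1].
Proof.
have lt_qn : q < n.+2 by lia.
have q_gt1 : 1 < q by lia.
have [sz ms] := matchingP _ _ matching_s.
have t1 : t.[1] = q by apply: (@nth_insert_arcl _ _ _ n).
have tq : t.[q] = 1 by apply: (@nth_insert_arcr _ _ _ n).
have tg i : i < n -> t.[gap 1 q i] = gap 1 q s.[i] by apply: nth_insert_gap.
have gapE i : gap 1 q i = (q <= (0 < i) + i) + ((0 < i) + i) by [].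
have gap_inj := can_inj (@gapK 1 q q_gt1).
have g0 : gap 1 q 0 = 0 by rewrite gapE; lia.
have gb : gap 1 q b.-1 = b by rewrite gapE; lia.
have gj : gap 1 q j.-1 = j by rewrite gapE; lia.
have t0 : t.[0] = gap 1 q s.[0] by rewrite -tg ?g0 //; lia.
have -> : (t.[0] == j) = (s.[0] == j.-1) by rewrite t0 -{1}gj (inj_eq gap_inj).
case: (s.[0] =P j.-1) => s0; rewrite ?andbF //=.
rewrite s0 gj in t0.
(* Only an arc starting at 0 could contain the inserted arc, but it ends at [j], before [q]. *)
have unt a : a < n -> unnested t (gap 1 q a) = unnested s a.
  move=> lt_an; rewrite (@unnested_insert _ _ _ n) //; case: a lt_an => [|a] _.
    by rewrite g0 s0 gj; lia.
  by rewrite [gap _ _ a.+1 < 1]negbTE ?andbT //; rewrite gapE; lia.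
have -> : (first_closure n.+2 t == b) = (first_closure n s == b.-1).
  have tb : t.[b] = gap 1 q s.[b.-1] by rewrite -{1}gb tg //; lia.
  apply/first_closureP/first_closureP; try lia; rewrite tb.
    case=> lt_tb H; split.
      have := ltn_gap q_gt1 s.[b.-1] b.-1; have := ltn_gap q_gt1 0 s.[b.-1].
      by rewrite gb g0; lia.
    move=> c lt_cb sc scc; apply: (H (gap 1 q c)).
    - by rewrite -gb ltn_gap.
    - by rewrite tg -1?[X in X < _]g0 ?ltn_gap; lia.
    by rewrite tg ?ltn_gap; lia.
  case=> lt_sb H; split.
    have := ltn_gap q_gt1 s.[b.-1] b.-1; have := ltn_gap q_gt1 0 s.[b.-1].
    by rewrite gb g0; lia.
  move=> c lt_cb.
  have [->|c_neq1] := eqVneq c 1; first by rewrite t1; lia.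
  have [e Ec] := @gap_surj 1 q q_gt1 c c_neq1 ltac:(lia).
  rewrite Ec -gb ltn_gap // in lt_cb *; have lt_en : e < n by lia.
  by rewrite tg // -[X in X < _ -> _]g0 !ltn_gap //; apply: H.
case: first_closureP; rewrite ?andbF ?andbT //; first by lia.
move=> [lt_sb no_closure].
have tb : t.[b] = gap 1 q s.[b.-1] by rewrite -{1}gb tg //; lia.
(* The arc ending at [b] starts after 1 and ends before [q], so it lies inside the inserted arc. *)
have nest1 : ~ unnested t 1.
  case/unnestedP; rewrite t1 => _ /(_ b lt_bq); apply; rewrite tb.
    by rewrite gapE; lia.
  by rewrite -[X in _ < X]gb ltn_gap; lia.
apply/coveredP/coveredP => cov p p_gt0 lt_pn.
  have [a [lt_a lt_ta una]] :=
    cov (gap 1 q p) ltac:(rewrite gapE; lia) ltac:(rewrite gapE; lia).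
  have [a1|a_neq1] := eqVneq a 1; first by rewrite a1 in una.
  have [aq|a_neqq] := eqVneq a q.
    by rewrite aq tq gapE in lt_ta; lia.
  have [e Ea] := gap_surj q_gt1 a_neq1 a_neqq.
  rewrite Ea ltn_gap // in lt_a; have lt_en : e < n by lia.
  by exists e; rewrite -(unt e) // -Ea -(ltn_gap q_gt1 p) -tg // -Ea.
have [p1|p_neq1] := eqVneq p 1.
  have [|a [lt_a1 lt_1sa una]] := cov 1 isT; first by lia.
  have a0 : a = 0 by lia.
  rewrite {a lt_a1 lt_1sa}a0 in una.
  by exists 0; rewrite p1 t0 -[X in unnested t X]g0 unt //; lia.
(* The end [q] is covered by whatever covers [q - 2] in [s]: that position becomes [q - 1], and the
   arc cannot end at [q], so it ends beyond. It is an interior position because [q <= n]. *)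
have [pq|p_neqq] := eqVneq p q.
  have [||a [lt_a lt_sa una]] := cov (q - 2); try lia.
  have gq : gap 1 q (q - 2) = q.-1 by rewrite gapE; lia.
  have lt_an : a < n by lia.
  exists (gap 1 q a); rewrite unt // tg // pq.
  move: lt_a lt_sa (gap_neqr q_gt1 s.[a]).
  by rewrite -(ltn_gap q_gt1) -(ltn_gap q_gt1 (q - 2)) gq; split=> //; lia.
have [e Ep] := gap_surj q_gt1 p_neq1 p_neqq.
have [||a [lt_ae lt_esa una']] := cov e; try by move: Ep; rewrite gapE; lia.
have lt_an : a < n by move: Ep; rewrite gapE; lia.
by exists (gap 1 q a); rewrite unt // tg // Ep !ltn_gap.
Qed.

End InsertSecondArc.

(** * The recurrence for matchings *)

Definition snake_jk n j k (s : seq nat) :=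
  [&& snake n s, s.[0].+1 == j & (first_closure n s).+1 == k].

Lemma cnt_snake m : 3 <= m ->
  cnt m.*2 (snake m.*2) =
  \sum_(5 <= k < m + 3) \sum_(3 <= j < k) cnt m.*2 (snake_jk m.*2 j k).
Proof.
move=> m_ge3; have n_ge4 : 4 <= m.*2 by lia.
rewrite (@cnt_split _ (fun s => (first_closure m.*2 s).+1) 5 (m + 3)); last first.
  move=> s sn; have := snake_first_closure_ge4 n_ge4 sn ltac:(lia).
  by have := snake_first_closure_le n_ge4 sn; lia.
apply: eq_bigr => k _; rewrite (@cnt_split _ (fun s => s.[0].+1) 3 k); last first.
  move=> s /andP[sn /eqP <-]; have [_ s0_ge2] := snake_first_arc n_ge4 sn.
  by have [] := snake_first_closure n_ge4 sn; lia.
by apply: eq_bigr => j _; apply: eq_cnt => s; rewrite /snake_jk andbA andbAC -andbA.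
Qed.

(** The snakes are classified by the mate of position 1. *)
Lemma cnt_snake_jk_rec m j k : 2 <= m -> 3 <= j < k -> 5 <= k <= m + 3 ->
  cnt m.+1.*2 (snake_jk m.+1.*2 j k) =
  \sum_(k - 1 <= l < m + 3) cnt m.*2 (snake_jk m.*2 (k - 2) l) +
  (2 * m + 1 - k) * cnt m.*2 (snake_jk m.*2 (j - 1) (k - 1)).
Proof.
rewrite doubleS; set n := m.*2 => m_ge2 jk k_range.
have n_ge4 : 4 <= n by lia.
(* A mate of 1 before [k.-1] would be an earlier closure. It remains to exclude the last position
   [n.+1]. *)
rewrite (@cnt_split _ (fun s => s.[1]) k.-1 n.+1); last first.
  move=> s /and3P[sn /eqP s0 /eqP fc].
  have := @snake_first_closure n.+2 s ltac:(lia) sn.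
  have Eb : first_closure n.+2 s = k.-1 by lia.
  rewrite Eb => -[_ lt_bn [sb H]].
  case/andP: sn => /matchingP[_ ms] /coveredP cov.
  have [m10 m11 m12] := ms 1 isT.
  apply/andP; split.
    rewrite leqNgt; apply/negP => lt_s1; apply: (H _ lt_s1); rewrite m12 //.
    have : s.[1] <> 0 by move=> E; rewrite E in m12; lia.
    by lia.
  (* The arc covering position [n] must end at [n.+1], so it would be the arc of 1; but this
     contains the arc ending at [k.-1]. *)
  rewrite ltn_neqAle -ltnS m10 andbT; apply/eqP => s1.
  have [a [lt_an lt_sa /unnestedP[una Ha]]] := cov n ltac:(lia) ltac:(lia).
  have [ma0 ma1 ma2] := ms a ltac:(lia).
  have a1 : a = 1 by rewrite -ma2 -m12; congr (s.[_]); lia.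
  have [mb0 mb1 mb2] := ms k.-1 lt_bn.
  apply: (Ha k.-1); rewrite ?a1; try lia.
  have : s.[k.-1] <> 1 by move=> E; rewrite E in mb2; lia.
  by lia.
(* The term [s.[1] = k.-1] is case A, the remaining terms are case B. *)
rewrite big_ltn; last by lia.
congr (_ + _).
  transitivity (cnt n (fun s => snake n s && (s.[0].+1 == k - 2))).
    rewrite (@eq_cnt _ _ (fun s => [&& matching n.+2 s, s.[0] == j.-1 &
      [&& covered n.+2 s, first_closure n.+2 s == k.-1 & s.[1] == k.-1]])).
      rewrite cnt_insert; last by lia.
      apply: eq_cnt => s; rewrite /snake -[RHS]andbA.
      case ms: (matching n s); rewrite ?andFb ?andTb //.
      by rewrite insert_first_arc //; lia.
    move=> s; rewrite /snake_jk /snake.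
    case: (matching _ _); rewrite ?andFb ?andTb //.
    have -> : (s.[0].+1 == j) = (s.[0] == j.-1) by lia.
    have -> : ((first_closure n.+2 s).+1 == k) = (first_closure n.+2 s == k.-1).
      by lia.
    by case: (covered _ _); case: (s.[0] == _); rewrite ?andbF.
  (* The closure of the shorter snake lies beyond [s.[0] = k - 3], whence the lower bound
     [k - 1]. *)
  rewrite (@cnt_split _ (fun s => (first_closure n s).+1) (k - 1) (m + 3)).
    by apply: eq_bigr => l _; apply: eq_cnt => s; rewrite /snake_jk andbA.
  move=> s /andP[sn s0]; have [lt_sb _ _] := snake_first_closure n_ge4 sn.
  by have := snake_first_closure_le n_ge4 sn; lia.
(* Each [q] from [k] to [n] contributes the same count, which gives the factor [2 * m + 1 - k]. *)
under eq_big_nat => q lt_q.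
  rewrite (@eq_cnt _ _ (fun s => [&& matching n.+2 s, s.[1] == q &
      [&& covered n.+2 s, s.[0] == j.-1 & first_closure n.+2 s == k.-1]])).
    rewrite cnt_insert; last by lia.
    rewrite (@eq_cnt _ _ (snake_jk n (j - 1) (k - 1))); first by over.
    move=> s; rewrite /snake_jk /snake -[RHS]andbA.
    case ms: (matching n s); rewrite ?andFb ?andTb //.
    by rewrite insert_second_arc //; lia.
  move=> s; rewrite /snake_jk /snake.
  case: (matching _ _); rewrite ?andFb ?andTb //.
  have -> : (s.[0].+1 == j) = (s.[0] == j.-1) by lia.
  have -> : ((first_closure n.+2 s).+1 == k) = (first_closure n.+2 s == k.-1).
    by lia.
  by case: (covered _ _); case: (s.[1] == _); rewrite ?andbF ?andbT.
rewrite sum_nat_const_nat; congr (_ * _); lia.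
Qed.

(** * Binary words and their matchings *)

Section Mates.

Variables (T : eqType) (x0 : T).
Implicit Types (W : seq T) (s : seq nat).

(** [s] is the involution exchanging the two occurrences of each letter. As a relation it serves
    both the sequence computed from a word and the word built from a matching. *)
Definition mates W s :=
  [/\ size s = size W,
      forall i, i < size W -> s.[i] < size W /\ s.[i] <> i &
      forall i j, i < size W -> j < size W ->
        (nth x0 W j == nth x0 W i) = (j == i) || (j == s.[i])].

Definition mate_seq W :=
  mkseq (fun i => find (fun j => (j != i) && (nth x0 W j == nth x0 W i))
                    (iota 0 (size W))) (size W).

Lemma count_mem_positions W x :
  count_mem x W = count (fun j => nth x0 W j == x) (iota 0 (size W)).
Proof. by rewrite -{1}(mkseq_nth x0 W) count_map. Qed.

Lemma binary_mates W : binary W -> mates W (mate_seq W).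
Proof.
move=> /allP binW; set n := size W.
have mate i : i < n ->
  [/\ (mate_seq W).[i] < n, (mate_seq W).[i] <> i & forall j, j < n ->
        (nth x0 W j == nth x0 W i) = (j == i) || (j == (mate_seq W).[i])].
  move=> lt_in; rewrite nth_mkseq // -/n; set p := fun j => _ && _.
  (* The positions of the letter at [i] form a list of size 2; the search in [mate_seq] must return
     its other member [y]. *)
  pose r := [seq j <- iota 0 n | nth x0 W j == nth x0 W i].
  have mem_r j : (j \in r) = (nth x0 W j == nth x0 W i) && (j < n).
    by rewrite mem_filter mem_iota.
  have uniq_r : uniq r by rewrite filter_uniq ?iota_uniq.
  have size_r : size r = 2.
    by rewrite size_filter -count_mem_positions; apply/eqP/binW/mem_nth.
  have i_r : i \in r by rewrite mem_r eqxx.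
  have [y neq_yi Er] : exists2 y, y != i & r =i [:: i; y].
    case: r uniq_r size_r i_r {mem_r} => [|u [|v [|? ?]]] //=.
    rewrite !inE andbT => neq_uv _ /orP[] /eqP->.
      by exists v; rewrite // eq_sym.
    by exists u => // z; rewrite !inE orbC.
  have : y \in r by rewrite Er !inE eqxx orbT.
  rewrite mem_r => /andP[Wy lt_yn].
  have has_p : has p (iota 0 n).
    by apply/hasP; exists y; rewrite ?mem_iota // /p neq_yi Wy.
  have lt_fn : find p (iota 0 n) < n by rewrite -{2}(size_iota 0 n) -has_find.
  have := nth_find 0 has_p; rewrite nth_iota // add0n /p => /andP[/eqP neq_f Wf].
  have Ef : find p (iota 0 n) = y.
    have : find p (iota 0 n) \in r by rewrite mem_r lt_fn Wf.
    by rewrite Er !inE => /orP[/eqP//|/eqP].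
  rewrite -/p Ef; split=> //; first exact/eqP.
  by move=> j lt_jn; have := mem_r j; rewrite lt_jn andbT Er !inE.
split; first by rewrite size_mkseq.
  by move=> i /mate[].
by move=> i j /mate[_ _]; apply.
Qed.

Section Fixed.

Variables (W : seq T) (s : seq nat).
Hypothesis mates_s : mates W s.
Let n := size W.

Lemma mates_binary : binary W.
Proof.
have [_ ms E] := mates_s.
apply/allP => x /(nthP x0)[i lt_in <-]; have [lt_si neq_si] := ms i lt_in.
rewrite count_mem_positions -size_filter.
rewrite (@perm_size _ _ [:: i; s.[i]]) //; apply: uniq_perm.
- by rewrite filter_uniq ?iota_uniq.
- by rewrite /= inE andbT eq_sym; apply/eqP.
move=> j; rewrite mem_filter mem_iota !inE /=; case: ltnP => lt_jn.
  by rewrite andbT E.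
by rewrite andbF; apply/esym/negbTE; rewrite negb_or; lia.
Qed.

Lemma mates_matching : matching n s.
Proof.
have [sz ms E] := mates_s.
apply/matchingP; split=> // i lt_in; have [lt_si neq_si] := ms i lt_in.
split=> //; have [lt_ssi neq_ssi] := ms _ lt_si.
have := E s.[i] i lt_si lt_in; rewrite eq_sym (E i) // eqxx orbT.
by case/esym/orP => /eqP E'; [case: neq_si |].
Qed.

(** Two equal letters of a segment are the two ends of an arc inside it. *)
Lemma mates_uniq_subword a b : b <= n ->
  reflect (forall d, d < b -> a <= s.[d] -> s.[d] < d -> False)
          (uniq (drop a (take b W))).
Proof.
have [sz ms E] := mates_s; move=> le_bn.
have szd : size (drop a (take b W)) = b - a by rewrite size_drop size_takel.
have nthd i : i < b - a -> nth x0 (drop a (take b W)) i = nth x0 W (a + i).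
  by move=> lti; rewrite nth_drop nth_take //; lia.
apply: (iffP (uniqP x0)); rewrite szd.
  move=> inj d lt_db le_a lt_sd.
  have [] := ms d ltac:(lia) => lt_sn _.
  suff : s.[d] - a = d - a by lia.
  apply: inj; rewrite ?unfold_in /=; try lia.
  rewrite !nthd ?subnKC; try lia.
  by apply/eqP; rewrite E ?eqxx ?orbT //; lia.
move=> H i j; rewrite !inE => lti ltj; rewrite !nthd // => /eqP.
have [szs mm] := matchingP _ _ mates_matching.
have [_ _ mi] := mm (a + i) ltac:(lia).
rewrite eq_sym E; try lia; rewrite eqn_add2l => /orP[/eqP//|/eqP Ej].
have [lt_ji|lt_ij|//] := ltngtP j i.
  by case: (H (a + i)); lia.
by case: (H (a + j)); rewrite ?Ej ?mi; lia.
Qed.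

(** Equal end letters mean an arc from [a] to [b]; as it ends outside the primitive part, only
    strictly nested arcs can spoil primitivity. *)
Lemma mates_semi_primitive a b : a < b -> b < n ->
  semi_primitive (subword W a.+1 b.+1) = (s.[a] == b) && unnested s a.
Proof.
have [sz ms E] := mates_s; move=> lt_ab lt_bn.
have lt_an : a < n by lia.
rewrite /subword /= (take_nth x0) // drop_rcons; last by rewrite size_takel; lia.
have Ed : drop a (take b W) = nth x0 W a :: drop a.+1 (take b W).
  by rewrite (drop_nth x0) ?nth_take // size_takel; lia.
rewrite Ed rcons_cons /semi_primitive last_rcons belast_rcons /primitive -Ed.
rewrite eq_sym E // gtn_eqF //= eq_sym.
case: eqP => //= Eb; apply/mates_uniq_subword/unnestedP; rewrite ?Eb; try lia.
  by move=> H; split=> // d ltd ? ?; apply: (H d) => //; lia.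
have [_ mm] := matchingP _ _ mates_matching.
case=> _ H d lt_db le_a lt_sd; apply: (H d) => //.
rewrite ltn_neqAle le_a andbT; apply/eqP => Ea.
by have [_ _] := mm d ltac:(lia); rewrite -Ea Eb; lia.
Qed.

Lemma mates_snake_name : 0 < n -> binary_snake_name W = snake n s.
Proof.
move=> n_gt0; rewrite /binary_snake_name /snake_name /snake mates_matching.
rewrite mates_binary andbT -size_eq0 -lt0n n_gt0 /=.
have -> : all (fun x => 2 <= count_mem x W) W.
  by apply: sub_all mates_binary => x /eqP->.
(* Position [k] of the word is position [k - 1] of the matching. *)
apply/forallP/coveredP => /= [cov p p_gt0 lt_pn|cov k].
  have lt_p : p.+1 < size W by [].
  have /existsP[j /existsP[l]] := implyP (cov (Ordinal lt_p)) p_gt0.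
  case/and4P => j_gt0 lt_jp lt_pl; move: lt_jp lt_pl; rewrite /= => lt_jp lt_pl.
  have := ltn_ord l; rewrite ltnS => le_ln.
  rewrite -(prednK j_gt0) -(ltn_predK lt_pl) mates_semi_primitive; try lia.
  by case/andP => /eqP Es un; exists j.-1; rewrite Es; split=> //; lia.
apply/implyP => k_ge2; have lt_kn := ltn_ord k.
have [||a [lt_a lt_sa un]] := cov k.-1; try lia.
have [_ mm] := matchingP _ _ mates_matching.
have [lt_sn _ _] := mm a ltac:(lia).
have lt_a1 : a.+1 < (size W).+1 by lia.
have lt_s1 : s.[a].+1 < (size W).+1 by lia.
apply/existsP; exists (Ordinal lt_a1); apply/existsP; exists (Ordinal lt_s1).
by rewrite /= mates_semi_primitive ?eqxx ?un; lia.
Qed.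

Lemma mates_param_j : 0 < n -> param_j W = s.[0].+1.
Proof.
rewrite /n; case: W mates_s => [|x W'] // [sz ms E] _ /=; congr _.+1.
have [lt_s0 s0_neq0] := ms 0 isT; rewrite /= in lt_s0.
have x_W' : x \in W'.
  have := E 0 s.[0] isT lt_s0; rewrite eqxx orbT.
  case: s.[0] s0_neq0 lt_s0 => [|i] // _ lt_i /eqP /= <-.
  exact: mem_nth.
have := E 0 (index x W').+1 isT; rewrite /= nth_index // eqxx.
by rewrite ltnS index_mem => /(_ x_W')/esym/eqP.
Qed.

(** [[w_2 ... w_k]] first repeats a letter when it reaches the right end of an arc starting after 0.
    If both searches fail they return [n.+1] and [n], which still agrees. *)
Lemma mates_param_k : param_k W = (first_closure n s).+1.
Proof.
have le_fn : first_closure n s <= n.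
  by rewrite -{2}(size_iota 0 n) find_size.
rewrite /param_k /subword /primitive; apply: find_iota => // [i|].
  move=> lt_i; apply/negPn/mates_uniq_subword; first by lia.
  move=> d lt_di sd0 lt_sd; have lt_df : d < first_closure n s by lia.
  by have := before_find 0 lt_df; rewrite nth_iota ?sd0 ?lt_sd //; lia.
rewrite ltnS => lt_fn; apply/mates_uniq_subword => // H.
have [/andP[]] := first_closureP s lt_fn (eqxx _).
by move=> ? ? _; apply: (H (first_closure n s)).
Qed.

Lemma mates_inj t : mates W t -> s = t.
Proof.
have [szs ms Es] := mates_s; case=> szt mt Et.
apply: (@eq_from_nth _ 0) => [|i]; first by rewrite szs szt.
rewrite szs => lt_in; have [lt_sn neq_si] := ms i lt_in.
have := Et i s.[i] lt_in lt_sn; rewrite Es // eqxx orbT.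
by case/esym/orP => /eqP.
Qed.

End Fixed.

End Mates.

(** Each position is labelled by the left end of its arc. *)
Lemma matching_realized n (x0 : 'I_n) s : matching n s ->
  exists W : n.-tuple 'I_n, mates x0 W s.
Proof.
case/matchingP => sz ms.
pose W := [tuple insubd x0 (minn i s.[i]) | i < n].
have nthW i : i < n -> val (nth x0 W i) = minn i s.[i].
  move=> lt_in; rewrite -(tnth_nth x0 W (Ordinal lt_in)) tnth_mktuple.
  by rewrite val_insubd /=; case: ltnP => //; lia.
exists W; split; rewrite size_tuple //.
  by move=> i /ms[].
move=> i j lt_in lt_jn; rewrite -val_eqE /= !nthW //.
have [? ? mi] := ms i lt_in; have [? ? mj] := ms j lt_jn.
apply/eqP/orP => [E|[/eqP->//|/eqP->]]; last by rewrite mi minnC.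
have [->|neq_ji] := eqVneq j i; [by left | right; apply/eqP].
have neq_s : s.[j] <> s.[i] by move=> Es; case/eqP: neq_ji; rewrite -mj Es mi.
have [Ej|Ei] : j = s.[i] \/ s.[j] = i by lia.
  by [].
by rewrite -Ei mj.
Qed.

(** * Equivalence classes of words as matchings *)

(** Each class is determined by the common value of [f] on it. The class map [h] and [f] have the
    same fibres on [D], so [undup] drops the same entries from both lists of values. *)
Lemma card_equivalence_partition (T : finType) (S : eqType) (f : T -> S)
    (R : rel T) (D : {set T}) :
  {in D &, forall x y, R x y = (f x == f y)} ->
  #|equivalence_partition R D| = size (undup (map f (enum D))).
Proof.
move=> Rf; rewrite /equivalence_partition.
set h := fun x => [set y in D | R x y].
have hf : {in D &, forall x y, (h x == h y) = (f x == f y)}.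
  move=> x y xD yD; apply/eqP/eqP => [/setP/(_ x)|Ef].
    by rewrite !inE xD !Rf // eqxx => /esym/eqP.
  by apply/setP => z; rewrite !inE; case: (boolP (z \in D)) => //= zD; rewrite !Rf // Ef.
transitivity (size (undup (map h (enum D)))).
  rewrite cardE; apply: perm_size; apply: uniq_perm.
  - exact: enum_uniq.
  - exact: undup_uniq.
  move=> A; rewrite mem_enum mem_undup.
  by apply/imsetP/mapP => -[x xD ->]; exists x; rewrite // mem_enum in xD *.
have : {subset enum D <= D} by move=> x; rewrite mem_enum.
elim: (enum D) => [|x e IH] sub //=.
have xD : x \in D by rewrite sub ?mem_head.
have sub_e : {subset e <= D} by move=> y ye; rewrite sub // inE ye orbT.
have -> : (h x \in map h e) = (f x \in map f e).
  by apply/mapP/mapP => -[y ye E]; exists y => //; apply/eqP; move/eqP: E;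
    rewrite hf ?(sub_e y) //.
by case: ifP => _ /=; rewrite IH.
Qed.

Lemma equivalentP n (T1 T2 : eqType) (U : n.-tuple T1) (V : n.-tuple T2) :
  reflect (forall i j, (tnth U i == tnth U j) = (tnth V i == tnth V j))
          (equivalent U V).
Proof.
rewrite /equivalent /position_partition /preim_partition.
apply: (iffP eqP) => [E i j|E].
  have eqv (T : eqType) (W : n.-tuple T) :
      {in [set: 'I_n] & &, equivalence_rel [rel x y | tnth W x == tnth W y]}.
    by split=> //= /eqP->.
  have := pblock_equivalence_partition (eqv _ U) (in_setT i) (in_setT j).
  rewrite /= => <-; rewrite E.
  by rewrite (pblock_equivalence_partition (eqv _ V)) ?in_setT.
by apply: eq_imset => i; apply/setP => j; rewrite !inE /= E.
Qed.

(** Binary words are equivalent exactly when their mate sequences agree, and every matching is the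
    mate sequence of some word. *)
Lemma nb_wordsE n (x0 : 'I_n) (P : pred (seq 'I_n)) (Q : pred (seq nat)) :
  (forall W : n.-tuple 'I_n, P W -> binary W) ->
  (forall s, Q s -> matching n s) ->
  (forall (W : n.-tuple 'I_n) s, mates x0 W s -> P W = Q s) ->
  nb_words P = cnt n Q.
Proof.
move=> Pbin Qm PQ; rewrite /nb_words /cnt.
have matesP (W : n.-tuple 'I_n) : P W -> mates x0 W (mate_seq x0 W).
  by move=> /Pbin; apply: binary_mates.
rewrite (@card_equivalence_partition _ _ (fun W : n.-tuple 'I_n => mate_seq x0 W)).
  rewrite -size_filter; apply: perm_size; apply: uniq_perm.
  - exact: undup_uniq.
  - by rewrite filter_uniq ?words_uniq.
  move=> s; rewrite mem_undup mem_filter; apply/mapP/andP.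
    case=> W; rewrite mem_enum inE => PW ->.
    have QW : Q (mate_seq x0 W) by rewrite -(PQ W) //; apply: matesP.
    by split=> //; apply/matching_words/Qm.
  case=> Qs _; have [W mW] := matching_realized x0 (Qm s Qs).
  have PW : P W by rewrite (PQ W s).
  by exists W; rewrite ?mem_enum ?inE //; apply: (mates_inj mW); apply: matesP.
move=> U V; rewrite !inE => PU PV.
have mU := matesP U PU; have mV := matesP V PV.
apply/equivalentP/eqP => [E|E i j].
  (* Equivalence makes the mate sequence of [V] one for [U] too, and mates are unique. *)
  apply: (mates_inj mU); case: mV => szV ltV EV; split.
  - by rewrite szV !size_tuple.
  - by move=> i; move: (ltV i); rewrite !size_tuple.
  move=> i j; rewrite size_tuple => lt_in lt_jn; rewrite -EV ?size_tuple //.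
  have := E (Ordinal lt_jn) (Ordinal lt_in).
  by rewrite !(tnth_nth x0).
case: mU => _ _ EU; case: mV => _ _ EV.
by rewrite !(tnth_nth x0) EU ?EV ?size_tuple // E.
Qed.

Lemma nb_snakesE m : 0 < m -> nb_snakes m = cnt m.*2 (snake m.*2).
Proof.
move=> m_gt0; have n_gt0 : 0 < 2 * m by lia.
rewrite -mul2n; apply: (@nb_wordsE _ (Ordinal n_gt0)).
- by move=> W /andP[].
- by move=> s /andP[].
by move=> W s mW; rewrite (mates_snake_name mW) ?size_tuple.
Qed.

Lemma nb_snakes_jkE m j k : 0 < m ->
  nb_snakes_jk m j k = cnt m.*2 (snake_jk m.*2 j k).
Proof.
move=> m_gt0; have n_gt0 : 0 < 2 * m by lia.
rewrite -mul2n; apply: (@nb_wordsE _ (Ordinal n_gt0)).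
- by move=> W /andP[/andP[]].
- by move=> s /andP[/andP[]].
move=> W s mW; rewrite (mates_snake_name mW) ?(mates_param_j mW) ?size_tuple //.
by rewrite (mates_param_k mW) size_tuple.
Qed.

Theorem theorem6p49 :
  [/\ nb_snakes 1 = 1,
      nb_snakes 2 = nb_snakes_jk 2 3 4 /\ nb_snakes_jk 2 3 4 = 1,
      forall m j k : nat, 2 <= m -> 3 <= j < k -> 5 <= k <= m + 3 ->
        nb_snakes_jk m.+1 j k = nb_snakesA m j k + nb_snakesB m j k
    & forall m : nat, 2 <= m ->
        nb_snakes m.+1 =
        \sum_(5 <= k < m + 4) \sum_(3 <= j < k) nb_snakes_jk m.+1 j k].
Proof.
split.
(* The base cases are computed over all words of length 2 and 4. *)
- by rewrite nb_snakesE //; vm_compute.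
- by rewrite nb_snakesE // nb_snakes_jkE //; split; vm_compute.
- move=> m j k m_ge2 jk k_range; have m_gt0 : 0 < m by lia.
  rewrite nb_snakes_jkE // cnt_snake_jk_rec // /nb_snakesA /nb_snakesB.
  rewrite nb_snakes_jkE //; congr (_ + _).
  by apply: eq_bigr => l _; rewrite nb_snakes_jkE.
move=> m m_ge2; rewrite nb_snakesE // cnt_snake // addSnnS.
by apply: eq_bigr => k _; apply: eq_bigr => j _; rewrite nb_snakes_jkE.
Qed.
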